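(* If the provers are honest and their individual operations satisfy $\bar{\mu} \geq h_k^{-1}(t) + \epsilon$, then the winning rate $R$ in the teleportation-based ping-pong test is bounded by $R \geq t$ with probability at least $1 - e^{-n\epsilon^2}$, where $t\in(\tfrac{5}{6},1]$ is a winning threshold and $h_k(\bar{\mu}) = \frac{\bar{\mu}(\bar{\mu}^k-1)}{k(\bar{\mu}-1)}$.
   Context: In the teleportation-based ping-pong test of maximum depth $k$, each of $n$ IID executions picks a depth $\kappa\in\{1,\dots,k\}$ uniformly, single-qubit Clifford gates $C_1,\dots,C_\kappa$ uniformly and a Pauli eigenstate $|\psi\rangle$ uniformly; the state is teleported back and forth between nodes $A$ and $B$ $\kappa$ times, at round $j$ undergoing the teleportation-and-memory channel $M^{\mathcal{T}}_j$ followed by $C_j$, and is finally measured with projector $\bigcirc_{j=1}^{\kappa}C_j(|\psi\rangle\langle\psi|)$, giving a bit $v^i\in\{0,1\}$ (1 = accept). The winning rate is $R=\frac{1}{n}\sum_i v^i$. The quality of memory and gates is assumed the same in every round, given by the average fidelity $\bar{\mu}=\int d\psi\,\mathrm{Tr}[C_j\circ M^{\mathcal{T}}_j(|\psi\rangle\langle\psi|)\cdot C_j(|\psi\rangle\langle\psi|)]$ for all $j$ (Haar measure $d\psi$). The accuracy $\epsilon$ is as in the Hoeffding bound $\Pr[|R-P_{\checkmark}|\le\epsilon]\ge 1-2e^{-2n\epsilon^2}$, with $P_{\checkmark}$ the average success probability. *)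

(* Defs.v *)
From HB Require Import structures.
From mathcomp Require Import all_boot all_algebra complex.
From mathcomp Require Import all_classical all_reals all_analysis.

Set Implicit Arguments.
Unset Strict Implicit.
Unset Printing Implicit Defensive.

Import GRing.Theory Num.Theory.
Local Open Scope ring_scope.

Section QubitDefs.
Variable R : realType.

Local Notation qmx := 'M[R[i]]_2.

Definition cR (x : R) : R[i] := Complex x 0.
Definition cI : R[i] := Complex 0 1.

Definition adj (A : qmx) : qmx := (map_mx Num.conj A)^T.

(* Pauli matrices: a = 0 -> X, a = 1 -> Y, a = 2 -> Z *)
Definition pauli (a : 'I_3) : qmx :=
  \matrix_(r < 2, c < 2)
    match nat_of_ord a with
    | 0%N => if r == c then 0 else 1
    | 1%N => if r == c then 0 else if nat_of_ord r == 0%N then - cI else cI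
    | _ => if r == c then (if nat_of_ord r == 0%N then 1 else -1) else 0
    end.

Definition is_unitary (U : qmx) : Prop := adj U *m U = 1%:M.

Definition is_clifford (U : qmx) : Prop :=
  is_unitary U /\
  forall a : 'I_3, exists b : 'I_3, exists s : bool,
      U *m pauli a *m adj U = (if s then -1 else 1) *: pauli b.

Definition uconj (U : qmx) (rho : qmx) : qmx := U *m rho *m adj U.

Definition clifford_enum (N : nat) (cl : 'I_N -> qmx) : Prop :=
  [/\ forall i, is_clifford (cl i),
      forall U, is_clifford U -> exists i, forall rho, uconj U rho = uconj (cl i) rho
    & forall i j, (forall rho, uconj (cl i) rho = uconj (cl j) rho) -> i = j].

Definition is_channel (K : seq qmx) : Prop := \sum_(A <- K) adj A *m A = 1%:M.
Definition kraus (K : seq qmx) (rho : qmx) : qmx := \sum_(A <- K) A *m rho *m adj A.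

Definition pauli_eig (p : bool * 'I_3) : qmx :=
  cR 2^-1 *: (1%:M + (if p.1 then 1 else -1) *: pauli p.2).

(* pure state with Bloch angles (theta, phi):
   |psi> = cos(theta/2)|0> + e^{i phi} sin(theta/2)|1> *)
Definition bloch_state (th ph : R) : qmx :=
  cR 2^-1 *: (1%:M + cR (sin th * cos ph) *: pauli 0
                   + cR (sin th * sin ph) *: pauli 1
                   + cR (cos th) *: pauli 2).

(* Haar (unitarily invariant) average of f over pure qubit states,
   i.e. the normalized uniform measure on the Bloch sphere *)
Definition haar_avg (f : qmx -> R) : R :=
  (4 * pi)^-1 *
  Rintegral (@lebesgue_measure R) `[0, pi]%classic
    (fun th => Rintegral (@lebesgue_measure R) `[0, 2 * pi]%classic
                 (fun ph => f (bloch_state th ph)) * sin th).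

Definition avg_fid (Phi Target : qmx -> qmx) : R :=
  haar_avg (fun rho => complex.Re (\tr (Phi rho *m Target rho))).

Fixpoint noisy_run (N : nat) (M : nat -> seq qmx) (cl : 'I_N -> qmx)
    (cs : seq 'I_N) (j : nat) (rho : qmx) : qmx :=
  match cs with
  | [::] => rho
  | c :: cs' => noisy_run M cl cs' j.+1 (uconj (cl c) (kraus (M j) rho))
  end.

Fixpoint ideal_run (N : nat) (cl : 'I_N -> qmx) (cs : seq 'I_N) (rho : qmx) : qmx :=
  match cs with
  | [::] => rho
  | c :: cs' => ideal_run cl cs' (uconj (cl c) rho)
  end.

(* average success probability P_check of one execution of the ping-pong
   test of maximum depth k: kappa uniform in {1..k}, Cliffords uniform,
   Pauli eigenstate uniform; rounds numbered 0..kappa-1 use M 0 .. M (kappa-1) *)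
Definition success_prob (N : nat) (cl : 'I_N -> qmx) (M : nat -> seq qmx) (k : nat) : R :=
  k%:R^-1 * \sum_(kap < k)
    (N%:R ^+ kap.+1)^-1 * \sum_(cs : (kap.+1).-tuple 'I_N)
      6^-1 * \sum_(p : bool * 'I_3)
        complex.Re (\tr (noisy_run M cl cs 0 (pauli_eig p) *m ideal_run cl cs (pauli_eig p))).

Definition win_rate (n : nat) (v : {ffun 'I_n -> bool}) : R :=
  n%:R^-1 * \sum_(i < n) (v i)%:R.

Definition prob_rate_ge (n : nat) (P t : R) : R :=
  \sum_(v : {ffun 'I_n -> bool} | t <= win_rate v)
     \prod_(i < n) (if v i then P else 1 - P).

(* h_k(mu) = mu (mu^k - 1) / (k (mu - 1)), extended continuously by 1 at mu = 1 *)
Definition hk (k : nat) (mu : R) : R :=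
  if mu == 1 then 1 else mu * (mu ^+ k - 1) / (k%:R * (mu - 1)).

End QubitDefs.

(* Main.v *)
(** In the Bloch picture a channel is an affine map [r |-> A r + b].  Averaging
    over antipodal inputs kills [b], and averaging over the Clifford group
    replaces [A] by [tr A / 3] times the identity, by invariance under the Paulis
    and under a cyclic permutation of the axes.  Hence a run of depth [m] succeeds
    with probability [(1 + f ^ m) / 2], where [f = tr A / 3]; integrating over the
    sphere gives [mu = (1 + f) / 2], so [f = 2 mu - 1].  By convexity
    [(1 + f ^ m) / 2 >= mu ^ m], and [(mu0 + eps) ^ m >= (1 + eps) mu0 ^ m], so the
    success probability is at least [(1 + eps) t >= t + 5 eps / 6].  As it also
    exceeds 5/6, one accept bit has variance at most 5/36, and Chernoff's bound
    with parameter [2 eps] gives the tail [exp (- n eps ^ 2)]. *)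

Require Import Defs.
From HB Require Import structures.
From mathcomp Require Import all_boot all_algebra complex.
From mathcomp Require Import all_classical all_reals all_analysis.
From mathcomp Require Import all_order ring lra.
Import Order.TTheory GRing.Theory Num.Theory.
Local Open Scope ring_scope.

(** * Concentration of the winning rate *)

Section Concentration.
Context {R : realType}.
Implicit Types (P s t x y : R).

Lemma ler_expr (n : nat) x y : 0 <= x -> x <= y -> x ^+ n <= y ^+ n.
Proof. by move=> x0 xy; apply: lerXn2r; rewrite // nnegrE (le_trans x0). Qed.

(** From [1 - y / 2 <= expR (- (y / 2))], squaring gives [expR y * (1 - y / 2) ^+ 2 <= 1]. The
    quadratic times the same square is at least 1, because the excess has the factor
    [1 - 3 * y + y ^+ 2]; this is where [y <= 3^-1] enters. *)
Lemma expR_le_quadratic y : y <= 3^-1 -> expR y <= 1 + y + y ^+ 2.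
Proof.
move=> y3; have h : 0 < 1 - y / 2 by lra.
have e1 : 1 - y / 2 <= expR (- (y / 2)) by rewrite expR_ge1Dx.
have e2 : expR y * expR (- (y / 2)) ^+ 2 = 1.
  by rewrite -expRM_natl -expRD -[RHS]expR0; congr expR; field.
have e3 : expR y * (1 - y / 2) ^+ 2 <= 1.
  by rewrite -[leRHS]e2 ler_pM2l ?expR_gt0// ler_expr// ltW.
have e4 : 1 <= (1 + y + y ^+ 2) * (1 - y / 2) ^+ 2.
  have -> : (1 + y + y ^+ 2) * (1 - y / 2) ^+ 2
     = 1 + (y / 2) ^+ 2 * (1 - 3 * y + y ^+ 2) by field.
  by rewrite lerDl mulr_ge0 ?sqr_ge0// addr_ge0 ?sqr_ge0//; lra.
by rewrite -(ler_pM2r (exprn_gt0 2 h)) (le_trans e3).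
Qed.

(** For the centred bit the linear terms of the quadratic bound cancel and the quadratic ones add up
    to [s ^+ 2] times the variance; [1 + x <= expR x] finishes. Keeping the variance, instead of
    Hoeffding's 1/4, is what yields the final constant. *)
Lemma bernoulli_mgf_le P s : 0 <= P -> P <= 1 -> 0 <= s -> s <= 3^-1 ->
  P * expR (- s) + (1 - P) <= expR (s ^+ 2 * (P * (1 - P)) - s * P).
Proof.
move=> P0 P1 s0 s3.
have -> : P * expR (- s) + (1 - P) =
    (P * expR (- (s * (1 - P))) + (1 - P) * expR (s * P)) * expR (- (s * P)).
  rewrite mulrDl -!mulrA -!expRD addrN expR0 mulr1; congr (P * expR _ + _); ring.
rewrite expRD ler_pM2r ?expR_gt0//.
have h1 : expR (- (s * (1 - P))) <= 1 - s * (1 - P) + (s * (1 - P)) ^+ 2.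
  have h : 0 <= s * (1 - P) by rewrite mulr_ge0// subr_ge0.
  rewrite -[X in _ + X ^+ 2]opprK sqrrN; apply: expR_le_quadratic.
  by rewrite (le_trans (y := 0))// ?oppr_le0// invr_ge0.
have h2 : expR (s * P) <= 1 + s * P + (s * P) ^+ 2.
  by apply: expR_le_quadratic; rewrite (le_trans _ s3)// ler_piMr.
apply: le_trans (expR_ge1Dx _).
apply: le_trans (lerD (ler_wpM2l P0 h1) (ler_wpM2l _ h2)) _.
  by rewrite subr_ge0.
rewrite le_eqVlt; apply/orP; left; apply/eqP; ring.
Qed.

(** The indicator of a rate below [t] is at most [expR (s * (n * t - sum of the bits))], whose
    expectation factors over the independent executions. *)
Lemma chernoff_prob_rate_ge (n : nat) P t s :
  (0 < n)%N -> 0 <= P -> P <= 1 -> 0 <= s ->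
  1 - (expR (s * t) * (P * expR (- s) + (1 - P))) ^+ n <= prob_rate_ge n P t.
Proof.
move=> n0 P0 P1 s0.
pose w (b : bool) : R := if b then P else 1 - P.
have w0 b : 0 <= w b by rewrite /w; case: b => //; rewrite subr_ge0.
have total : \sum_(v : {ffun 'I_n -> bool}) \prod_(i < n) w (v i) = 1.
  rewrite -(bigA_distr_bigA (fun=> w)) big1// => i _.
  by rewrite big_bool /w /= addrC subrK.
rewrite lerBlDr -[leLHS]total /prob_rate_ge.
rewrite (bigID (fun v : {ffun 'I_n -> bool} => t <= win_rate R v))/= lerD2l.
pose g (b : bool) := expR (s * t) * (w b * expR (- (s * b%:R))).
have -> : (expR (s * t) * (P * expR (- s) + (1 - P))) ^+ n =
    \sum_(v : {ffun 'I_n -> bool}) \prod_(i < n) g (v i).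
  rewrite -(bigA_distr_bigA (fun=> g)) big_const_ord iter_mulr_1; congr (_ ^+ _).
  by rewrite big_bool /g /w /= -mulrDr mulr1 mulr0 oppr0 expR0 mulr1.
rewrite big_mkcond/=; apply: ler_sum => v _.
have g0 : 0 <= \prod_(i < n) g (v i).
  by apply: prodr_ge0 => i _; rewrite !mulr_ge0// expR_ge0.
(* Only outcomes with rate below [t] remain; for them the exponential factor is at least 1. *)
case: ifPn => // ; rewrite -ltNge => vt.
rewrite /g !big_split/= mulrCA -[leLHS]mulr1; apply: ler_wpM2l; first exact: prodr_ge0.
rewrite -!expR_sum -expRD -[leLHS]expR0 ler_expR.
rewrite sumrN big_const_ord iter_addr_0 -mulr_sumr -mulrnAr -mulrBr mulr_ge0//.
rewrite subr_ge0 -mulr_natl; move: vt; rewrite /win_rate => /ltW.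
by rewrite ler_pdivrMl ?ltr0n.
Qed.

End Concentration.

(** * The function [hk] and the average over the depth *)

Section Depth.
Context {R : realType}.
Implicit Types (mu x eps t : R).

(** A geometric sum; this polynomial form also covers the removable singularity at 1. *)
Lemma hkE (k : nat) mu : (0 < k)%N ->
  hk k mu = k%:R^-1 * \sum_(i < k) mu ^+ i.+1.
Proof.
move=> k0; have k0' : k%:R != 0 :> R by rewrite pnatr_eq0 -lt0n.
rewrite /hk; case: eqVneq => [->|m1].
  under eq_bigr do rewrite expr1n.
  by rewrite sumr_const card_ord mulVf.
have m1' : mu - 1 != 0 by rewrite subr_eq0.
under eq_bigr do rewrite exprS.
by rewrite -mulr_sumr subrX1; field; rewrite k0'.
Qed.

(** Convexity of the power between 1 and [x]. In the induction the gap is a quarter of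
    [(1 - x ^+ m) * (1 - x)]. *)
Lemma midpoint_expr_le x (m : nat) : 0 <= x -> x <= 1 ->
  ((1 + x) / 2) ^+ m <= (1 + x ^+ m) / 2.
Proof.
move=> x0 x1; elim: m => [|m IH]; first by rewrite !expr0; lra.
rewrite exprSr; apply: le_trans (ler_wpM2r _ IH) _; first by lra.
have xm : x ^+ m <= 1 by rewrite exprn_ile1.
have : 0 <= (1 - x ^+ m) * (1 - x) by rewrite mulr_ge0// subr_ge0.
rewrite exprSr; lra.
Qed.

(** Since [mu0 <= 1], the base [mu0 + eps] dominates [(1 + eps) * mu0], and a positive power of
    [1 + eps] is at least [1 + eps]. *)
Lemma expr_ge_scaled mu0 eps (m : nat) : 0 <= mu0 -> mu0 <= 1 -> 0 <= eps ->
  (1 + eps) * mu0 ^+ m.+1 <= (mu0 + eps) ^+ m.+1.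
Proof.
move=> m0 m1 e0.
have h : (1 + eps) * mu0 <= mu0 + eps.
  have : eps * mu0 <= eps by rewrite ler_piMr. lra.
apply: (@le_trans _ _ (((1 + eps) * mu0) ^+ m.+1)).
  rewrite exprMn ler_wpM2r ?exprn_ge0// ler_eXnr//; lra.
apply: ler_expr => //; rewrite mulr_ge0//; lra.
Qed.

Lemma hk_le_id (k : nat) mu : (0 < k)%N -> 0 <= mu -> mu <= 1 -> hk k mu <= mu.
Proof.
move=> k0 m0 m1; rewrite hkE// ler_pdivrMl ?ltr0n//.
rewrite mulr_natl -[X in _ *+ X]card_ord -sumr_const; apply: ler_sum => i _.
by rewrite exprS ler_piMr// exprn_ile1.
Qed.

Lemma depth_average_ge (k : nat) mu0 mu eps : (0 < k)%N ->
  0 <= mu0 -> mu0 <= 1 -> 0 <= eps -> mu0 + eps <= mu -> 2^-1 <= mu -> mu <= 1 ->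
  (1 + eps) * hk k mu0 <=
  k%:R^-1 * \sum_(i < k) (1 + (2 * mu - 1) ^+ i.+1) / 2.
Proof.
move=> k0 m0 m1 e0 em mu2 mu1; rewrite hkE// mulrCA ler_wpM2l ?invr_ge0//.
rewrite mulr_sumr; apply: ler_sum => i _.
apply: le_trans (expr_ge_scaled _ _ _ m0 m1 e0) _.
have -> : mu = (1 + (2 * mu - 1)) / 2 by field.
apply: le_trans (_ : _ <= ((1 + (2 * mu - 1)) / 2) ^+ i.+1) _.
  by apply: ler_expr; lra.
(* The rewriting of [mu] as a midpoint also reached the right-hand side; this undoes it there. *)
have -> : 2 * ((1 + (2 * mu - 1)) / 2) - 1 = 2 * mu - 1 by field.
by apply: midpoint_expr_le; lra.
Qed.

(** Chernoff with parameter [2 * eps], admissible for the moment bound because [eps <= 6^-1]. In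
    units of [eps ^+ 2], the drift [2 * eps * (t - P)] contributes at most -5/3 and the variance
    term at most 5/9, a total of -10/9. *)
Lemma prob_rate_ge_threshold (n : nat) P t eps : (0 < n)%N -> P <= 1 ->
  0 < eps -> eps <= 6^-1 -> 5 / 6 < t -> (1 + eps) * t <= P ->
  1 - expR (- (n%:R * eps ^+ 2)) <= prob_rate_ge n P t.
Proof.
move=> n0 P1 e0 e6 t56 tP.
have et : eps * (5 / 6) <= eps * t by rewrite ler_pM2l// ltW.
have P56 : 5 / 6 <= P by lra.
have s0 : 0 <= 2 * eps by lra.
have P0 : 0 <= P by lra.
apply: le_trans (chernoff_prob_rate_ge n P t (2 * eps) n0 P0 P1 s0).
rewrite lerB// -[X in _ <= expR X]mulrN [leRHS]expRM_natl.
have mgf0 : 0 <= P * expR (- (2 * eps)) + (1 - P).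
  by rewrite addr_ge0 ?mulr_ge0 ?expR_ge0// subr_ge0.
apply: ler_expr; first by rewrite mulr_ge0 ?expR_ge0.
apply: le_trans (ler_wpM2l (expR_ge0 _) (bernoulli_mgf_le P (2 * eps) P0 P1 s0 _)) _.
  lra.
rewrite -expRD ler_expR.
(* The variance decreases on [1/2, 1] and equals 5/36 at 5/6. *)
have var : P * (1 - P) <= 5 / 36.
  have : 0 <= (P - 5 / 6) * (P - 1 / 6) by rewrite mulr_ge0; lra.
  lra.
have : eps ^+ 2 * (P * (1 - P)) <= eps ^+ 2 * (5 / 36) by rewrite ler_wpM2l ?sqr_ge0.
have : eps * ((1 + eps) * t) <= eps * P by apply: ler_wpM2l => //; exact: ltW.
have : eps ^+ 2 * (5 / 6) <= eps ^+ 2 * t.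
  by apply: ler_wpM2l; [exact: sqr_ge0 | exact: ltW].
have := sqr_ge0 eps.
rewrite !expr2; lra.
Qed.

End Depth.

(** * Averages over the Bloch sphere *)

Section BlochIntegral.
Import numFieldNormedType.Exports.
Context {R : realType}.

Lemma Rintegral_FTC2 (f F : R -> R) (a b : R) : a < b ->
  (forall x : R, is_derive x (1 : R) F (f x)) ->
  (forall x : R, derivable f x (1 : R)) ->
  Rintegral (@lebesgue_measure R) `[a, b]%classic f = F b - F a.
Proof.
move=> ab dF cf.
have cF (x : R) : {for x, continuous F}.
  apply: differentiable_continuous; apply/derivable1_diffP.
  by case: (dF x).
rewrite /Rintegral (@continuous_FTC2 _ f F a b ab) //.
- apply: continuous_subspaceT => x.
  by apply: differentiable_continuous; apply/derivable1_diffP; exact: cf.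
- split.
  + by move=> x _; case: (dF x).
  + by apply: cvg_at_right_filter; exact: cF.
  + by apply: cvg_at_left_filter; exact: cF.
- by move=> x _; rewrite derive1E; apply: derive_val.
Qed.

Lemma Rintegral_azimuth (c0 c1 c2 c3 c4 c5 : R) :
  Rintegral (@lebesgue_measure R) `[0, 2 * pi]%classic
    (fun x : R => c0 + c1 * cos x + c2 * sin x + c3 * cos x ^+ 2
      + c4 * sin x ^+ 2 + c5 * (cos x * sin x))
  = pi * (2 * c0 + c3 + c4).
Proof.
(* An explicit primitive; its periodic terms cancel over a full turn. *)
pose F (x : R) := c0 * x + c1 * sin x - c2 * cos x
  + c3 * (2^-1 * (x + sin x * cos x)) + c4 * (2^-1 * (x - sin x * cos x))
  + c5 * (2^-1 * sin x ^+ 2).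
transitivity (F (2 * pi) - F 0); first apply: (Rintegral_FTC2 _ F).
- by rewrite mulr_gt0// pi_gt0.
- move=> x; rewrite /F; apply: is_derive_eq.
  rewrite /GRing.scale /=.
  have e := cos2Dsin2 x.
  (* The derivative of [x] is the constant 1; writing it as [cos ^+ 2 + sin ^+ 2] leaves an identity
     that [field] can check. *)
  rewrite -[X in c3 * (2^-1 * (X + _))]e -[X in c4 * (2^-1 * (X - _))]e; field => //.
- by move=> x; apply: ex_derive.
- rewrite /F mulr_natl sin2pi cos2pi sin0 cos0; field => //.
Qed.

Lemma Rintegral_polar (d0 d1 d2 : R) :
  Rintegral (@lebesgue_measure R) `[0, pi]%classic
    (fun x : R => (d0 + d1 * cos x + d2 * cos x ^+ 2) * sin x)
  = 2 * (d0 + d2 / 3).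
Proof.
pose F (x : R) := - (d0 * cos x + d1 / 2 * cos x ^+ 2 + d2 / 3 * cos x ^+ 3).
transitivity (F pi - F 0); last by rewrite /F cospi cos0; field => //.
apply: (Rintegral_FTC2 _ F).
- exact: pi_gt0.
- move=> x; rewrite /F; apply: is_derive_eq. rewrite /GRing.scale /=. field => //.
- by move=> x; apply: ex_derive.
Qed.

(** On the uniform sphere the coordinates and their mixed products average to 0, and each squared
    coordinate averages to 1/3 by symmetry. *)
Lemma haar_avg_quadratic (f : 'M[R[i]]_2 -> R)
    (q0 q1 q2 q3 p11 p22 p33 p12 p13 p23 : R) :
  (forall th ph, f (bloch_state th ph) =
    let x := sin th * cos ph in let y := sin th * sin ph in let z := cos th in
    q0 + q1 * x + q2 * y + q3 * z + p11 * x ^+ 2 + p22 * y ^+ 2 + p33 * z ^+ 2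
    + p12 * (x * y) + p13 * (x * z) + p23 * (y * z)) ->
  haar_avg f = q0 + (p11 + p22 + p33) / 3.
Proof.
move=> fE; rewrite /haar_avg.
(* Coefficients, in powers of [cos th], of the azimuthal integral once [sin th ^+ 2] is
   eliminated. *)
pose d0 := pi * (2 * q0 + p11 + p22).
pose d1 := 2 * pi * q3.
pose d2 := pi * (2 * p33 - p11 - p22).
have -> : (fun th : R => Rintegral (@lebesgue_measure R) `[0, 2 * pi]%classic
      (fun ph => f (bloch_state th ph)) * sin th) =
    (fun th : R => (d0 + d1 * cos th + d2 * cos th ^+ 2) * sin th).
  apply/funext => th; congr (_ * _).
  transitivity (pi * (2 * (q0 + q3 * cos th + p33 * cos th ^+ 2)
                      + p11 * sin th ^+ 2 + p22 * sin th ^+ 2)).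
    rewrite -(Rintegral_azimuth _ (q1 * sin th + p13 * (sin th * cos th))
      (q2 * sin th + p23 * (sin th * cos th)) _ _ (p12 * sin th ^+ 2)).
    by congr Rintegral; apply/funext => ph; rewrite fE /=; ring.
  by rewrite /d0 /d1 /d2 sin2cos2; ring.
rewrite Rintegral_polar /d0 /d2; have := @pi_gt0 R; move: (pi : R) => p p0.
by field; rewrite gt_eqF.
Qed.

End BlochIntegral.

(** * Twirling over the Clifford group *)

Section Qubit.
Context {R : realType}.
Local Notation C := (R[i]).
Local Notation qmx := 'M[C]_2.
Local Notation pauli := (@pauli R).
Local Notation is_unitary := (@Defs.is_unitary R).
Implicit Types (A B U V X Y : qmx) (K : seq qmx) (a b : 'I_3) (x : R) (z : C).

(** * Two-by-two matrices, Pauli matrices and unitary conjugation *)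

Lemma sum_ord2 (G : nmodType) (F : 'I_2 -> G) : \sum_(i < 2) F i = F 0 + F 1.
Proof.
by rewrite !big_ord_recl big_ord0 addr0; congr (_ + F _); apply: val_inj.
Qed.

Lemma sum_ord3 (G : nmodType) (F : 'I_3 -> G) :
  \sum_(i < 3) F i = F 0 + F 1 + F 2.
Proof.
rewrite !big_ord_recl big_ord0 addr0 addrA.
by congr (_ + F _ + F _); apply: val_inj.
Qed.

Lemma mul2mxE A B i j : (A *m B) i j = A i 0 * B 0 j + A i 1 * B 1 j.
Proof. by rewrite !mxE sum_ord2. Qed.

Lemma tr2mxE A : \tr A = A 0 0 + A 1 1.
Proof. by rewrite /mxtrace sum_ord2. Qed.

Lemma mx2P A B : A 0 0 = B 0 0 -> A 0 1 = B 0 1 -> A 1 0 = B 1 0 ->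
  A 1 1 = B 1 1 -> A = B.
Proof.
move=> h00 h01 h10 h11; apply/matrixP => i j.
have ordE (k : 'I_2) : k = 0 \/ k = 1.
  by case: k => [[|[|//]] p]; [left|right]; apply: val_inj.
by case: (ordE i) (ordE j) => -> [] ->.
Qed.

Lemma complexP z z' :
  complex.Re z = complex.Re z' -> complex.Im z = complex.Im z' -> z = z'.
Proof. by case: z z' => x y [x' y'] /= -> ->. Qed.

Lemma conj_complexE z : Num.conj z = Complex (complex.Re z) (- complex.Im z).
Proof. by case: z. Qed.

Lemma cR_nat (n : nat) : cR n%:R = n%:R :> C.
Proof. exact: (rmorph_nat (real_complex R)). Qed.

Lemma cRM x y : cR (x * y) = cR x * cR y :> C.
Proof. exact: (rmorphM (real_complex R)). Qed.

Lemma adjE A i j : adj A i j = Num.conj (A j i).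
Proof. by rewrite !mxE. Qed.

Lemma adjM A B : adj (A *m B) = adj B *m adj A.
Proof. by rewrite /adj map_mxM trmx_mul. Qed.

Lemma adjK A : adj (adj A) = A.
Proof. by apply/matrixP => i j; rewrite !adjE conjCK. Qed.

Lemma ord3_case (P : 'I_3 -> Prop) : P 0 -> P 1 -> P 2 -> forall a, P a.
Proof.
move=> p0 p1 p2 [[|[|[|//]]] h].
- by have -> : Ordinal h = 0 by apply: val_inj.
- by have -> : Ordinal h = 1 by apply: val_inj.
- by have -> : Ordinal h = 2 by apply: val_inj.
Qed.

Lemma ord3_cyclic (G : Type) (g : 'I_3 -> G) :
  (forall b, g (b + 1) = g b) -> forall b, g b = g 0.
Proof.
move=> step; have e1 : g 1 = g 0 by rewrite -(step 0); congr g; apply: val_inj.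
by elim/ord3_case => //; rewrite -e1 -(step 1); congr g; apply: val_inj.
Qed.

Lemma pauli0E : ((pauli 0 0 0 = 0) * (pauli 0 0 1 = 1) *
  (pauli 0 1 0 = 1) * (pauli 0 1 1 = 0))%type.
Proof. by rewrite !mxE. Qed.

Lemma pauli1E : ((pauli 1 0 0 = 0) * (pauli 1 0 1 = - cI R) *
  (pauli 1 1 0 = cI R) * (pauli 1 1 1 = 0))%type.
Proof. by rewrite !mxE. Qed.

Lemma pauli2E : ((pauli 2 0 0 = 1) * (pauli 2 0 1 = 0) *
  (pauli 2 1 0 = 0) * (pauli 2 1 1 = -1))%type.
Proof. by rewrite !mxE. Qed.

Definition pauliE := (pauli0E, pauli1E, pauli2E).

Lemma id2mxE : (((1%:M : qmx) 0 0 = 1) * ((1%:M : qmx) 0 1 = 0) *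
  ((1%:M : qmx) 1 0 = 0) * ((1%:M : qmx) 1 1 = 1))%type.
Proof. by rewrite !mxE. Qed.

Lemma cI_sqr : cI R * cI R = -1.
Proof. by apply: complexP => /=; ring. Qed.

Lemma adj_pauli a : adj (pauli a) = pauli a.
Proof.
elim/ord3_case: a; apply: mx2P;
  by rewrite adjE !pauliE conj_complexE; apply: complexP; rewrite /= ?oppr0 ?opprK.
Qed.

Lemma pauli_conj a b :
  pauli b *m pauli a *m pauli b = (if a == b then 1 else -1) *: pauli a.
Proof.
elim/ord3_case: a; elim/ord3_case: b; apply: mx2P;
  rewrite !mul2mxE [RHS]mxE !pauliE /= ?(mul0r, mulr0, mul1r, mulr1, add0r, addr0,
    mulrN, mulNr, oppr0, opprK, cI_sqr, mulrN1, mulN1r, cI_sqr)//.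
Qed.

Lemma pauli_sqr a : pauli a *m pauli a = 1%:M.
Proof.
elim/ord3_case: a; apply: mx2P;
  by rewrite !mul2mxE id2mxE !pauliE ?(mul0r, mulr0, mul1r, mulr1, add0r, addr0,
    mulrN, mulNr, oppr0, opprK, cI_sqr, mulrN1, mulN1r).
Qed.

Lemma pauli_unitary a : is_unitary (pauli a).
Proof. by rewrite /is_unitary adj_pauli pauli_sqr. Qed.

Lemma uconj_pauli a b :
  uconj (pauli b) (pauli a) = (if a == b then 1 else -1) *: pauli a.
Proof. by rewrite /uconj adj_pauli pauli_conj. Qed.

Lemma pauli_clifford b : is_clifford (pauli b).
Proof.
split; first exact: pauli_unitary.
move=> a; exists a, (a != b); rewrite -/(uconj _ _) uconj_pauli.
by case: eqP.
Qed.

Lemma unitaryC U : is_unitary U -> U *m adj U = 1%:M.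
Proof. exact: mulmx1C. Qed.

Lemma uconjM U V X : uconj (U *m V) X = uconj U (uconj V X).
Proof. by rewrite /uconj adjM !mulmxA. Qed.

Lemma uconj1 U : is_unitary U -> uconj U 1%:M = 1%:M.
Proof. by move=> uU; rewrite /uconj mulmx1 unitaryC. Qed.

Lemma uconj_mul U X Y : is_unitary U -> uconj U X *m uconj U Y = uconj U (X *m Y).
Proof.
by move=> uU; rewrite /uconj !mulmxA -(mulmxA _ (adj U) U) uU mulmx1.
Qed.

Lemma trmx_uconj U X : is_unitary U -> \tr (uconj U X) = \tr X.
Proof. by move=> uU; rewrite /uconj mxtrace_mulC mulmxA uU mul1mx. Qed.

Lemma uconjZ U z X : uconj U (z *: X) = z *: uconj U X.
Proof. by rewrite /uconj -scalemxAr -scalemxAl. Qed.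

Lemma uconjD U X Y : uconj U (X + Y) = uconj U X + uconj U Y.
Proof. by rewrite /uconj mulmxDr mulmxDl. Qed.

Lemma clifford_mul U V : is_clifford U -> is_clifford V -> is_clifford (U *m V).
Proof.
move=> [uU cU] [uV cV]; split.
  by rewrite /is_unitary adjM -mulmxA (mulmxA (adj U)) uU mul1mx.
move=> a; have [b [s hs]] := cV a; have [b' [s' hs']] := cU b.
exists b', (s (+) s'); rewrite -/(uconj _ _) uconjM {2}/uconj hs uconjZ.
rewrite /uconj hs' scalerA; congr (_ *: _).
by case: s s' {hs hs'} => [] []; rewrite /= ?mulrNN ?mulr1 ?mul1r.
Qed.

(* The rotation of the Bloch sphere by 120 degrees about (1,1,1), that is
   (1 - i(X + Y + Z)) / 2, which permutes X, Y, Z cyclically. *)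
Definition cyc : qmx := \matrix_(r, c)
  Complex (if (r == 0) && (c == 1) then - 2^-1 else 2^-1)
          (if (r == 1) && (c == 1) then 2^-1 else - 2^-1).

Lemma cycE : ((cyc 0 0 = Complex 2^-1 (- 2^-1)) * (cyc 0 1 = Complex (- 2^-1) (- 2^-1)) *
  (cyc 1 0 = Complex 2^-1 (- 2^-1)) * (cyc 1 1 = Complex 2^-1 2^-1))%type.
Proof. by rewrite !mxE. Qed.

Lemma cyc_unitary : is_unitary cyc.
Proof.
apply: mx2P; rewrite !mul2mxE !adjE id2mxE !cycE !conj_complexE;
  apply: complexP => /=; field => //.
Qed.

Lemma uconj_cyc a : uconj cyc (pauli a) = pauli (a + 1).
Proof.
have e : (2 + 1 = 0 :> 'I_3) * (1 + 1 = 2 :> 'I_3) * (0 + 1 = 1 :> 'I_3).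
  by do !split; apply: val_inj.
elim/ord3_case: a; rewrite e /uconj; apply: mx2P;
rewrite !mul2mxE !adjE !pauliE !cycE !conj_complexE;
  apply: complexP => /=; field => //.
Qed.

Lemma cyc_clifford : is_clifford cyc.
Proof.
split; first exact: cyc_unitary.
by move=> a; exists (a + 1), false; rewrite -/(uconj _ _) uconj_cyc scale1r.
Qed.

Lemma id_clifford : is_clifford (1%:M : qmx).
Proof.
have e : adj (1%:M : qmx) = 1%:M by rewrite /adj map_mx1 trmx1.
split; first by rewrite /is_unitary e mulmx1.
by move=> a; exists a, false; rewrite e mulmx1 mul1mx scale1r.
Qed.

(** * Channels as bilinear forms in the Pauli basis *)

Lemma krausZ K z X : kraus K (z *: X) = z *: kraus K X.
Proof.
rewrite /kraus scaler_sumr; apply: eq_bigr => A _.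
by rewrite -scalemxAr -scalemxAl.
Qed.

Lemma krausD K X Y : kraus K (X + Y) = kraus K X + kraus K Y.
Proof.
by rewrite /kraus -big_split; apply: eq_bigr => A _; rewrite mulmxDr mulmxDl.
Qed.

Lemma trmx_kraus K X : is_channel K -> \tr (kraus K X) = \tr X.
Proof.
move=> cK; rewrite /kraus raddf_sum /=.
under eq_bigr do rewrite mxtrace_mulC mulmxA.
by rewrite -raddf_sum -mulmx_suml cK mul1mx.
Qed.

(** Both the fidelity and the success probability are read off this form; being bilinear, it is
    determined by its values on the identity and the Paulis. *)
Definition chan_form K X Y : C := \tr (kraus K X *m Y).

Lemma chan_formZl K z X Y : chan_form K (z *: X) Y = z * chan_form K X Y.
Proof. by rewrite /chan_form krausZ -scalemxAl mxtraceZ. Qed.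

Lemma chan_formZr K z X Y : chan_form K X (z *: Y) = z * chan_form K X Y.
Proof. by rewrite /chan_form -scalemxAr mxtraceZ. Qed.

Lemma chan_formDl K X X' Y :
  chan_form K (X + X') Y = chan_form K X Y + chan_form K X' Y.
Proof. by rewrite /chan_form krausD mulmxDl mxtraceD. Qed.

Lemma chan_formDr K X Y Y' :
  chan_form K X (Y + Y') = chan_form K X Y + chan_form K X Y'.
Proof. by rewrite /chan_form mulmxDr mxtraceD. Qed.

Lemma chan_form11 K : is_channel K -> chan_form K 1%:M 1%:M = 2.
Proof. by move=> cK; rewrite /chan_form mulmx1 trmx_kraus// mxtrace1. Qed.

Definition sqmod z : R := complex.Re z ^+ 2 + complex.Im z ^+ 2.

(* The factor by which the Clifford twirl of the channel shrinks the Bloch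
   ball, in terms of the traces of the Kraus operators. *)
Definition shrink K : R := (\sum_(A <- K) sqmod (\tr A) - 1) / 3.

(** Summing [P *m B *m P] over the identity and the three Paulis gives [2 * \tr B] times the
    identity; the subtracted trace is the identity term. *)
Lemma pauli_twirl_trace A :
  \sum_a \tr (A *m pauli a *m adj A *m pauli a)
  = 2 * cR (sqmod (\tr A)) - \tr (adj A *m A).
Proof.
rewrite sum_ord3 !tr2mxE !mul2mxE !adjE !pauliE !conj_complexE /sqmod.
move: (A 0 0) (A 0 1) (A 1 0) (A 1 1) => [a0 a1] [b0 b1] [c0 c1] [d0 d1].
by apply: complexP => /=; ring.
Qed.

(** The unitary [U] can be moved onto the Kraus operators, as [adj U *m A *m U]; this changes
    neither their traces nor those of [adj A *m A]. *)
Lemma chan_form_sum_uconj K U : is_channel K -> is_unitary U ->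
  \sum_a chan_form K (uconj U (pauli a)) (uconj U (pauli a)) = cR (6 * shrink K).
Proof.
move=> cK uU; rewrite /chan_form /kraus.
pose W A := adj U *m A *m U.
have WE A a : \tr (A *m uconj U (pauli a) *m adj A *m uconj U (pauli a)) =
    \tr (W A *m pauli a *m adj (W A) *m pauli a).
  by rewrite /W /uconj !adjM adjK !mulmxA [LHS]mxtrace_mulC !mulmxA.
under eq_bigr => a _.
  rewrite mulmx_suml raddf_sum /=.
  under eq_bigr do rewrite WE.
  over.
rewrite exchange_big /=.
under eq_bigr => A _.
  rewrite pauli_twirl_trace.
  have -> : \tr (W A) = \tr A by rewrite /W mxtrace_mulC mulmxA unitaryC// mul1mx.
  have -> : \tr (adj (W A) *m W A) = \tr (adj A *m A).
    rewrite /W !adjM adjK !mulmxA -(mulmxA _ U (adj U)) unitaryC// mulmx1.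
    by rewrite mxtrace_mulC !mulmxA unitaryC// mul1mx.
  over.
rewrite sumrB -mulr_sumr -(raddf_sum (@mxtrace _ _)) /= cK mxtrace1.
have -> : \sum_(A <- K) cR (sqmod (\tr A)) = cR (\sum_(A <- K) sqmod (\tr A)).
  by symmetry; exact: (raddf_sum (real_complex R)).
rewrite /shrink; move: (\sum_(A <- K) _) => S.
by apply: complexP => /=; field.
Qed.

(** Cauchy-Schwarz bounds each squared trace by [2 * \tr (adj A *m A)], and these sum to 4. This
    will force the fidelity to be at most 1. *)
Lemma shrink_le1 K : is_channel K -> shrink K <= 1.
Proof.
move=> cK.
suff : \sum_(A <- K) sqmod (\tr A) <= 4 by rewrite /shrink; lra.
have -> : 4 = complex.Re (\sum_(A <- K) 2 * \tr (adj A *m A)).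
  rewrite -mulr_sumr -(raddf_sum (@mxtrace _ _)) /= cK mxtrace1 /=; ring.
rewrite (raddf_sum (@complex.Re R)) /=; apply: ler_sum => A _.
rewrite !tr2mxE !mul2mxE !adjE !conj_complexE /sqmod.
move: (A 0 0) (A 0 1) (A 1 0) (A 1 1) => [a0 a1] [b0 b1] [c0 c1] [d0 d1] /=.
rewrite -subr_ge0.
set e := (X in 0 <= X).
have -> : e = (a0 - d0) ^+ 2 + (a1 - d1) ^+ 2
    + 2 * (b0 ^+ 2 + b1 ^+ 2 + c0 ^+ 2 + c1 ^+ 2).
  by rewrite /e; ring.
by do ![exact: sqr_ge0 | apply: addr_ge0 | apply: mulr_ge0].
Qed.

Lemma pauli_decomposition X :
  X = (\tr X / 2) *: 1%:M + \sum_a (\tr (pauli a *m X) / 2) *: pauli a.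
Proof.
have cI0 : 1 + cI R * cI R = 0 by rewrite cI_sqr addrN.
rewrite sum_ord3; apply: mx2P; rewrite !mxE !tr2mxE !mul2mxE !pauliE /=.
- by field.
(* [field] does not know that [cI] squares to -1, so the zero on the right is presented as a
   multiple of [1 + cI R * cI R]. *)
- apply/subr0_eq; rewrite -[RHS](mul0r ((X 0 1 - X 1 0) / 2)) -[X in _ = X * _]cI0.
  by field.
- apply/subr0_eq; rewrite -[RHS](mul0r ((X 1 0 - X 0 1) / 2)) -[X in _ = X * _]cI0.
  by field.
- by field.
Qed.

(** The sum of the tensor squares of the Paulis is twice the swap minus the identity. *)
Lemma sum_pauli_coef X Y :
  \sum_a \tr (pauli a *m X) * \tr (pauli a *m Y)
  = 2 * \tr (X *m Y) - \tr X * \tr Y.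
Proof.
rewrite sum_ord3 !tr2mxE !mul2mxE !pauliE.
move: (X 0 0) (X 0 1) (X 1 0) (X 1 1) (Y 0 0) (Y 0 1) (Y 1 0) (Y 1 1).
move=> [a0 a1] [b0 b1] [c0 c1] [d0 d1] [a2 a3] [b2 b3] [c2 c3] [d2 d3].
by apply: complexP => /=; ring.
Qed.

(** Such a form is diagonal in the Pauli basis; expanding both arguments there leaves [u] times the
    product of identity coefficients plus [v] times the dot product of the Bloch vectors. *)
Lemma isotropic_form (T : qmx -> qmx -> C) (u v : C) :
  (forall z X Y, T (z *: X) Y = z * T X Y) ->
  (forall z X Y, T X (z *: Y) = z * T X Y) ->
  (forall X X' Y, T (X + X') Y = T X Y + T X' Y) ->
  (forall X Y Y', T X (Y + Y') = T X Y + T X Y') ->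
  T 1%:M 1%:M = u ->
  (forall a, T 1%:M (pauli a) = 0) -> (forall a, T (pauli a) 1%:M = 0) ->
  (forall a b, a != b -> T (pauli a) (pauli b) = 0) ->
  (forall a, T (pauli a) (pauli a) = v) ->
  forall X Y, T X Y =
    u * (\tr X * \tr Y / 4) + v * (\tr (X *m Y) / 2 - \tr X * \tr Y / 4).
Proof.
move=> TZl TZr TDl TDr T11 T1p Tp1 Tpp_neq Tpp X Y.
have Tsumr Z (y : 'I_3 -> C) :
    T Z (\sum_a y a *: pauli a) = \sum_a y a * T Z (pauli a).
  by rewrite !sum_ord3 !TDr !TZr.
have Tsuml Z (x : 'I_3 -> C) :
    T (\sum_a x a *: pauli a) Z = \sum_a x a * T (pauli a) Z.
  by rewrite !sum_ord3 !TDl !TZl.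
rewrite [in LHS](pauli_decomposition X) [in LHS](pauli_decomposition Y).
have -> : \tr (X *m Y) / 2 - \tr X * \tr Y / 4 =
    \sum_a (\tr (pauli a *m X) / 2) * (\tr (pauli a *m Y) / 2).
  transitivity (4^-1 * \sum_a \tr (pauli a *m X) * \tr (pauli a *m Y)).
    by rewrite sum_pauli_coef; field.
  by rewrite mulr_sumr; apply: eq_bigr => a _; field.
move: (fun a => \tr (pauli a *m X) / 2) (fun a => \tr (pauli a *m Y) / 2) => x y.
rewrite TDl !TDr !TZl !TZr T11 Tsumr Tsuml big1 => [|a _]; last by rewrite T1p mulr0.
rewrite big1 => [|a _]; last by rewrite Tp1 mulr0.
rewrite Tsuml !mulr0 addr0 add0r mulr_sumr; congr (_ + _); first by field.
apply: eq_bigr => a _; rewrite Tsumr (bigD1 a)//= big1 => [|b ba]; last first.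
  by rewrite Tpp_neq ?mulr0// eq_sym.
by rewrite Tpp; ring.
Qed.

(** * Averaging a channel over the enumerated Clifford group *)

Section CliffordAverage.
Context {N : nat} (cl : 'I_N -> qmx).
Hypothesis clE : clifford_enum cl.

Lemma clifford_card_gt0 : (0 < N)%N.
Proof.
case: clE => _ ex _; have [i _] := ex _ id_clifford.
exact: leq_ltn_trans (ltn_ord i).
Qed.

Lemma enum_unitary c : is_unitary (cl c).
Proof. by case: clE => h _ _; case: (h c). Qed.

(** Right multiplication by [V] permutes the enumeration, up to phases that conjugation does not
    see. *)
Lemma clifford_sum_invariant (F : qmx -> qmx -> C) V X Y : is_clifford V ->
  \sum_c F (uconj (cl c) (uconj V X)) (uconj (cl c) (uconj V Y))
  = \sum_c F (uconj (cl c) X) (uconj (cl c) Y).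
Proof.
case: clE => clcl clex clinj cV.
have /choice[h hE] : forall c, exists c', forall X,
    uconj (cl c *m V) X = uconj (cl c') X.
  by move=> c; apply: clex; apply: clifford_mul.
(* Equal conjugations after [V] are equal before it: evaluate them at [uconj (adj V) Z]. *)
have hinj : injective h.
  move=> c c' hcc; apply: clinj => Z.
  have -> : Z = uconj V (uconj (adj V) Z).
    rewrite -uconjM unitaryC; last by case: cV.
    by rewrite /uconj /adj map_mx1 trmx1 mulmx1 mul1mx.
  by rewrite -!uconjM !(uconjM _ (adj V)) !hE hcc.
rewrite [RHS](reindex_inj hinj) /=; apply: eq_bigr => c _.
by rewrite -!uconjM !hE.
Qed.

Variable K : seq qmx.
Hypothesis cK : is_channel K.

Let T X Y : C := \sum_c chan_form K (uconj (cl c) X) (uconj (cl c) Y).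

Let TZl z X Y : T (z *: X) Y = z * T X Y.
Proof. by rewrite mulr_sumr; apply: eq_bigr => c _; rewrite uconjZ chan_formZl. Qed.

Let TZr z X Y : T X (z *: Y) = z * T X Y.
Proof. by rewrite mulr_sumr; apply: eq_bigr => c _; rewrite uconjZ chan_formZr. Qed.

Let TDl X X' Y : T (X + X') Y = T X Y + T X' Y.
Proof. by rewrite -big_split; apply: eq_bigr => c _; rewrite uconjD chan_formDl. Qed.

Let TDr X Y Y' : T X (Y + Y') = T X Y + T X Y'.
Proof. by rewrite -big_split; apply: eq_bigr => c _; rewrite uconjD chan_formDr. Qed.

Let Tinv V X Y : is_clifford V -> T (uconj V X) (uconj V Y) = T X Y.
Proof. exact: clifford_sum_invariant. Qed.

Let T11 : T 1%:M 1%:M = 2 * N%:R.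
Proof.
rewrite /T; under eq_bigr => c _ do rewrite (uconj1 _ (enum_unitary c)) chan_form11//.
by rewrite sumr_const card_ord mulr_natr.
Qed.

Let uconj_pauli1 b : uconj (pauli b) 1%:M = 1%:M.
Proof. by rewrite uconj1//; exact: pauli_unitary. Qed.

Let add1_neq a : (a == a + 1) = false.
Proof. by elim/ord3_case: a. Qed.

(** Conjugation by the next Pauli fixes the identity and negates [pauli a], so the value equals its
    own opposite. *)
Let T1p a : T 1%:M (pauli a) = 0.
Proof.
apply/eqP; rewrite -eqNr -[X in _ == X](Tinv _ _ _ (pauli_clifford (a + 1))).
by rewrite uconj_pauli1 uconj_pauli add1_neq TZr mulN1r.
Qed.

Let Tp1 a : T (pauli a) 1%:M = 0.
Proof.
apply/eqP; rewrite -eqNr -[X in _ == X](Tinv _ _ _ (pauli_clifford (a + 1))).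
by rewrite uconj_pauli1 uconj_pauli add1_neq TZl mulN1r.
Qed.

Let Tpp_neq a b : a != b -> T (pauli a) (pauli b) = 0.
Proof.
move=> ab; apply/eqP; rewrite -eqNr -[X in _ == X](Tinv _ _ _ (pauli_clifford b)).
by rewrite !uconj_pauli eqxx (negPf ab) TZl TZr mul1r mulN1r.
Qed.

(** The cyclic rotation makes the three diagonal values equal, and their sum is known for every
    Clifford. *)
Let Tpp a : T (pauli a) (pauli a) = N%:R * cR (2 * shrink K).
Proof.
have step b : T (pauli (b + 1)) (pauli (b + 1)) = T (pauli b) (pauli b).
  by rewrite -!uconj_cyc (Tinv _ _ _ cyc_clifford).
have Tcst b : T (pauli b) (pauli b) = T (pauli 0) (pauli 0) := 
  ord3_cyclic _ (fun b => T (pauli b) (pauli b)) step b.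
have : \sum_b T (pauli b) (pauli b) = N%:R * cR (6 * shrink K).
  rewrite /T exchange_big /=.
  under eq_bigr => c _ do rewrite (chan_form_sum_uconj _ _ cK (enum_unitary c)).
  by rewrite sumr_const card_ord [RHS]mulr_natl.
under eq_bigr do rewrite Tcst.
rewrite sumr_const card_ord Tcst => h.
apply: (mulfI (_ : 3 != 0 :> C)); first by rewrite pnatr_eq0.
rewrite [LHS]mulr_natl h [RHS]mulrCA; congr (_ * _).
by rewrite !cRM !cR_nat; ring.
Qed.

(** The averaged form is that of a depolarizing channel; the factor [N%:R] is there because the sum
    is not normalized. *)
Lemma clifford_twirl X Y :
  \sum_c chan_form K (uconj (cl c) X) (uconj (cl c) Y)
  = N%:R * (\tr X * \tr Y / 2 +
      cR (shrink K) * (\tr (X *m Y) - \tr X * \tr Y / 2)).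
Proof.
rewrite -/(T X Y) (isotropic_form _ _ _ TZl TZr TDl TDr T11 T1p Tp1 Tpp_neq Tpp).
by rewrite cRM cR_nat; field.
Qed.

End CliffordAverage.

End Qubit.

(** * The ping-pong protocol *)

Lemma sum_tuple_cons (G : nmodType) (T : finType) (m : nat)
    (F : m.+1.-tuple T -> G) :
  \sum_(t : m.+1.-tuple T) F t = \sum_(x : T) \sum_(t : m.-tuple T) F [tuple of x :: t].
Proof.
rewrite pair_big /= (reindex (fun p : T * m.-tuple T => [tuple of p.1 :: p.2])) //=.
exists (fun t : m.+1.-tuple T => (thead t, [tuple of behead t])).
  by move=> [x t] _ /=; congr pair; apply: val_inj.
by move=> t _; rewrite [RHS]tuple_eta.
Qed.

Section PingPong.
Context {R : realType}.
Local Notation C := (R[i]).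
Local Notation qmx := 'M[C]_2.
Local Notation pauli := (@pauli R).
Local Notation pauli_eig := (@pauli_eig R).
Implicit Types (X Y : qmx) (K : seq qmx).

Lemma ReD (z z' : C) : complex.Re (z + z') = complex.Re z + complex.Re z'.
Proof. exact: (raddfD (@complex.Re R)). Qed.

Lemma Re_cR (x : R) : complex.Re (cR x) = x.
Proof. by []. Qed.

Lemma Re_cRM (x : R) (z : C) : complex.Re (cR x * z) = x * complex.Re z.
Proof. by case: z => a b /=; ring. Qed.

(** Linearity is asked for real scalars only, since the intended [T] is the real part of a complex
    form. The result has the shape expected by [haar_avg_quadratic]. *)
Lemma bloch_quadratic (V : lmodType C) (T : V -> V -> R)
    (E P0 P1 P2 : V) (x y z : R) :
  (forall a (X Y : V), T (cR a *: X) Y = a * T X Y) ->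
  (forall a (X Y : V), T X (cR a *: Y) = a * T X Y) ->
  (forall X X' Y : V, T (X + X') Y = T X Y + T X' Y) ->
  (forall X Y Y' : V, T X (Y + Y') = T X Y + T X Y') ->
  let rho := cR 2^-1 *: (E + cR x *: P0 + cR y *: P1 + cR z *: P2) in
  T rho rho = T E E / 4 + (T E P0 / 4 + T P0 E / 4) * x
    + (T E P1 / 4 + T P1 E / 4) * y + (T E P2 / 4 + T P2 E / 4) * z
    + T P0 P0 / 4 * x ^+ 2 + T P1 P1 / 4 * y ^+ 2 + T P2 P2 / 4 * z ^+ 2
    + (T P0 P1 / 4 + T P1 P0 / 4) * (x * y)
    + (T P0 P2 / 4 + T P2 P0 / 4) * (x * z)
    + (T P1 P2 / 4 + T P2 P1 / 4) * (y * z).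
Proof.
move=> TZl TZr TDl TDr rho.
by rewrite /rho !(TZl, TDl) !(TZr, TDr); field.
Qed.

Lemma chan_form_sum_pauli K : is_channel K ->
  \sum_a chan_form K (pauli a) (pauli a) = cR (6 * shrink K).
Proof.
move=> cK; rewrite -(chan_form_sum_uconj K 1%:M cK (proj1 id_clifford)).
apply: eq_bigr => a _.
by rewrite /uconj /adj map_mx1 trmx1 mulmx1 mul1mx.
Qed.

(** The unitary cancels inside the trace; the identity term gives 1/2 and the three Pauli terms
    together give half of [shrink K]. *)
Lemma avg_fid_shrink K U : is_channel K -> Defs.is_unitary U ->
  avg_fid (fun rho => uconj U (kraus K rho)) (uconj U) = (1 + shrink K) / 2.
Proof.
move=> cK uU.
pose b X Y := complex.Re (chan_form K X Y) / 4.
rewrite /avg_fid (haar_avg_quadratic _ (b 1%:M 1%:M)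
  (b 1%:M (pauli 0) + b (pauli 0) 1%:M) (b 1%:M (pauli 1) + b (pauli 1) 1%:M)
  (b 1%:M (pauli 2) + b (pauli 2) 1%:M)
  (b (pauli 0) (pauli 0)) (b (pauli 1) (pauli 1)) (b (pauli 2) (pauli 2))
  (b (pauli 0) (pauli 1) + b (pauli 1) (pauli 0))
  (b (pauli 0) (pauli 2) + b (pauli 2) (pauli 0))
  (b (pauli 1) (pauli 2) + b (pauli 2) (pauli 1))).
  have := chan_form_sum_pauli K cK; rewrite sum_ord3 => /(congr1 (@complex.Re R)).
  rewrite !ReD Re_cR /b chan_form11// -cR_nat Re_cR => e.
  lra.
move=> th ph; rewrite uconj_mul// trmx_uconj// -/(chan_form K _ _) /bloch_state.
apply: (bloch_quadratic _ (fun X Y => complex.Re (chan_form K X Y))) => *.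
- by rewrite chan_formZl Re_cRM.
- by rewrite chan_formZr Re_cRM.
- by rewrite chan_formDl ReD.
- by rewrite chan_formDr ReD.
Qed.

Lemma cR_half : 2 * cR 2^-1 = 1 :> C.
Proof. by rewrite -cR_nat -cRM mulfV ?pnatr_eq0. Qed.

(** The cross terms are odd in the sign and cancel, which removes the translation part of the Bloch
    map. *)
Lemma antipodal_sum (V : lmodType C) (T : V -> V -> C) (E P : V) :
  (forall a (X Y : V), T (a *: X) Y = a * T X Y) ->
  (forall a (X Y : V), T X (a *: Y) = a * T X Y) ->
  (forall X X' Y : V, T (X + X') Y = T X Y + T X' Y) ->
  (forall X Y Y' : V, T X (Y + Y') = T X Y + T X Y') ->
  let rho s := cR 2^-1 *: (E + s *: P) in
  T (rho 1) (rho 1) + T (rho (-1)) (rho (-1)) = cR 2^-1 * (T E E + T P P).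
Proof.
move=> TZl TZr TDl TDr rho; have := cR_half; rewrite /rho; move: (cR _) => h hE.
rewrite !(TZl, TDl) !(TZr, TDr) -[in RHS](mul1r h) -[in RHS]hE.
by ring.
Qed.

Lemma chan_form_sum_eig K : is_channel K ->
  \sum_(p : bool * 'I_3) chan_form K (pauli_eig p) (pauli_eig p)
  = cR (3 * (1 + shrink K)).
Proof.
move=> cK.
rewrite -(pair_big xpredT xpredT (fun s a =>
  chan_form K (pauli_eig (s, a)) (pauli_eig (s, a)))) /=.
rewrite big_bool /= -big_split /=.
under eq_bigr => a _ do rewrite (antipodal_sum _ _ _ _ (chan_formZl K)
  (chan_formZr K) (chan_formDl K) (chan_formDr K)).
rewrite -mulr_sumr big_split sumr_const card_ord.
rewrite (chan_form_sum_pauli K cK) (chan_form11 K cK) -(cR_nat 2).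
by apply: complexP => /=; field => //.
Qed.

Lemma tr_pauli_eig (p : bool * 'I_3) : \tr (pauli_eig p) = 1.
Proof.
case: p => s a; rewrite mxtraceZ mxtraceD mxtraceZ mxtrace1 /=.
have -> : \tr (pauli a) = 0 by elim/ord3_case: a; rewrite tr2mxE !pauliE ?addr0 ?addrN.
by rewrite mulr0 addr0 mulrC cR_half.
Qed.

(** * Summing over all runs of the protocol *)

Section Protocol.
Context {N : nat} {cl : 'I_N -> qmx} {M : nat -> seq qmx} {k : nat} {phi : R}.
Hypothesis clE : clifford_enum cl.
Hypothesis chan : forall j, (j < k)%N -> is_channel (M j).
Hypothesis shrinkE : forall j, (j < k)%N -> shrink (M j) = phi.

(** The last Clifford cancels between the noisy and the ideal run, so [m.+1] rounds yield only [m]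
    twirls, and the first channel, which precedes every Clifford, stays untwirled. *)
Lemma sum_run (m j : nat) X Y : (j + m < k)%N ->
  \sum_(cs : m.+1.-tuple 'I_N)
     \tr (noisy_run M cl cs j X *m ideal_run cl cs Y)
  = N%:R ^+ m.+1 * (\tr X * \tr Y / 2 +
      cR phi ^+ m * (chan_form (M j) X Y - \tr X * \tr Y / 2)).
Proof.
elim: m j X Y => [|m IH] j X Y jk; rewrite sum_tuple_cons /=.
  rewrite expr0 mul1r addrC subrK expr1.
  under eq_bigr => c _.
    rewrite (big_pred1 [tuple]) /=; last by move=> t; rewrite (tuple0 t); apply/esym/eqP.
    rewrite uconj_mul ?trmx_uconj; [|exact: enum_unitary..].
    over.
  by rewrite sumr_const card_ord mulr_natl.
have jk' : (j < k)%N by apply: leq_ltn_trans jk; exact: leq_addr.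
have j1k : (j.+1 < k)%N by apply: leq_ltn_trans jk; rewrite addnS ltnS leq_addr.
under eq_bigr => c _.
  rewrite IH ?addSnnS// !trmx_uconj; [|exact: enum_unitary..].
  rewrite trmx_kraus; last exact: chan.
  over.
rewrite -mulr_sumr big_split /= sumr_const -mulr_sumr sumrB.
(* The Clifford of round [j] twirls the channel of round [j.+1]. *)
rewrite clifford_twirl//; last exact: chan.
rewrite shrinkE// trmx_kraus; last exact: chan.
rewrite sumr_const card_ord -(mulr_natr (\tr X * \tr Y / 2) N).
rewrite -[chan_form (M j) X Y]/(\tr (kraus (M j) X *m Y)).
move: (\tr (kraus _ _ *m _)) (\tr X * \tr Y / 2) => u v.
by rewrite !exprS; ring.
Qed.

(** Averaging the input over the six Pauli eigenstates does for the first channel what the Cliffords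
    do for the others, and supplies the missing factor [phi]. *)
Lemma success_probE : success_prob cl M k =
  k%:R^-1 * \sum_(i < k) (1 + phi ^+ i.+1) / 2.
Proof.
rewrite /success_prob; congr (_ * _); apply: eq_bigr => i _.
have k0 : (0 < k)%N by apply: leq_ltn_trans (ltn_ord i).
have N0 : N%:R != 0 :> R by rewrite pnatr_eq0 -lt0n; exact: clifford_card_gt0 clE.
rewrite -mulr_sumr exchange_big /=.
under eq_bigr => p _.
  rewrite -(raddf_sum (@complex.Re R)) /= sum_run ?add0n ?ltn_ord//.
  rewrite tr_pauli_eig.
  over.
rewrite -(raddf_sum (@complex.Re R)) /= -mulr_sumr.
rewrite big_split /= sumr_const -mulr_sumr sumrB.
rewrite chan_form_sum_eig ?shrinkE//; last exact: chan.
rewrite !sumr_const card_prod card_bool card_ord.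
have half : (1 * 1 / 2 : C) *+ (2 * 3) = cR 3 by rewrite cR_nat -[LHS]mulr_natl; field.
rewrite half.
have NE : N%:R ^+ i.+1 = cR (N%:R ^+ i.+1) :> C.
  by rewrite -cR_nat -(rmorphXn (real_complex R)).
have pE : cR phi ^+ i = cR (phi ^+ i) :> C.
  by rewrite -(rmorphXn (real_complex R)).
rewrite NE pE Re_cRM ReD Re_cRM /= [phi ^+ _.+1]exprS.
by move: (N%:R ^+ i.+1) (expf_neq0 i.+1 N0) => d d0; field.
Qed.

End Protocol.
End PingPong.

(** Here [mu0] is the inverse image of [t] under [hk k], unique because that function is strictly
    increasing on [0, 1]. *)
Theorem theorem3 (R : realType) (k n N : nat)
    (cl : 'I_N -> 'M[R[i]]_2) (M : nat -> seq 'M[R[i]]_2)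
    (mu t eps mu0 : R) :
  (0 < k)%N -> (0 < n)%N ->
  clifford_enum cl ->
  (forall j, (j < k)%N -> is_channel (M j)) ->
  (forall j, (j < k)%N -> forall c : 'I_N,
      avg_fid (fun rho => uconj (cl c) (kraus (M j) rho)) (uconj (cl c)) = mu) ->
  5 / 6 < t -> t <= 1 -> 0 < eps ->
  0 <= mu0 -> mu0 <= 1 -> hk k mu0 = t ->
  mu0 + eps <= mu ->
  1 - expR (- (n%:R * eps ^+ 2)) <= prob_rate_ge n (success_prob cl M k) t.
Proof.
move=> k0 n0 clE chan fid t56 t1 e0 m0 m1 hkt mue.
(* The fidelity assumption is indexed by a Clifford, so one must be exhibited before it can be
   used. *)
have c : 'I_N by exact: Ordinal (clifford_card_gt0 cl clE).
have shrinkE j : (j < k)%N -> shrink (M j) = 2 * mu - 1.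
  move=> jk; rewrite -(fid j jk c) avg_fid_shrink; [by field | exact: chan |].
  exact: enum_unitary.
have mu1 : mu <= 1.
  by have := shrink_le1 (M 0%N) (chan 0%N k0); rewrite shrinkE//; lra.
(* With [mu <= 1] this forces [eps] below 1/6, and it puts [2 * mu - 1] in [0, 1]. *)
have mu056 : 5 / 6 < mu0 by apply: lt_le_trans t56 _; rewrite -hkt hk_le_id.
rewrite (success_probE clE chan shrinkE).
apply: prob_rate_ge_threshold => //; last 2 first.
- by lra.
- by rewrite -hkt; apply: depth_average_ge => //; lra.
rewrite ler_pdivrMl ?ltr0n// mulr1 -[X in _ <= X%:R]card_ord -sumr_const.
apply: ler_sum => i _.
have : (2 * mu - 1) ^+ i.+1 <= 1 by rewrite exprn_ile1//; lra.
lra.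
Qed.
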